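(* Let $\mathcal T_h$ be a simplicial mesh such that each element $K\in\mathcal T_h$ is the image of a fixed reference simplex $\hat K\subset\mathbb R^d$ (with faces $\hat F_0,\dots,\hat F_d$) under an affine bijection $\Phi_K:\hat K\to K$. For each $j=0,\dots,d$ put $F_j:=\Phi_K(\hat F_j)$ and let $\Phi_{K,j}=\Phi_K|_{\hat F_j}$ be the restriction of $\Phi_K$ to $\hat F_j$. Let weights and test functions $\hat\Omega,\hat\omega_j,\hat\rho_k,\hat\psi_j,\hat q_j$ on $\hat K$, and $\Omega_K,\omega_{K,j},\rho_{K,k},\psi_{K,j},q_{K,j}$ on each $K\in\mathcal T_h$, be as in the local setting of the context (with the matrix $M$ invertible). Assume that the following conditions hold: (1) for any $f\in L^1(K)$, $\int_K f(\boldsymbol\sigma)\,\Omega_K(\boldsymbol\sigma)\,d\boldsymbol\sigma=\int_{\hat K}f(\Phi_K(\hat{\boldsymbol\sigma}))\,\hat\Omega(\hat{\boldsymbol\sigma})\,d\hat{\boldsymbol\sigma}$; (2) for each face $\hat F_j\subset\hat K$ and any $g\in L^1(F_j)$, $\int_{F_j}g(\boldsymbol x)\,\omega_{K,j}(\boldsymbol x)\,d\boldsymbol x=\int_{\hat F_j}g(\Phi_{K,j}(\hat{\boldsymbol x}))\,\hat\omega_j(\hat{\boldsymbol x})\,d\hat{\boldsymbol x}$; (3) for each $K$, $\rho_{K,k}(\boldsymbol\sigma)=\hat\rho_k(\Phi_K^{-1}(\boldsymbol\sigma))$ for $\boldsymbol\sigma\in K$, $k=1,\dots,\tilde d$; $\psi_{K,j}(\boldsymbol\sigma)=\hat\psi_j(\Phi_K^{-1}(\boldsymbol\sigma))$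 for $\boldsymbol\sigma\in K$, $j=0,\dots,d$; and $q_{K,j}(\boldsymbol x)=\hat q_j(\Phi_{K,j}^{-1}(\boldsymbol x))$ for $\boldsymbol x\in F_j$, $j=0,\dots,d$; (4) the reduced stability matrix $\hat S$ on $\hat K$ is symmetric positive definite. Then the associated local moment matrices $(G_K,C_K,\tilde C_K,M_K)$ coincide, for all $K\in\mathcal T_h$, with the corresponding matrices $(G,C,\tilde C,M)$ on $\hat K$. In particular, the reduced stability matrices $\hat S_K$ and the local inf--sup constants $\beta_K$ are independent of $K$ and of $h$, and satisfy $\beta_K=\beta>0$, where $\beta$ is the inf--sup constant on $\hat K$.
   Context: Local setting on a nondegenerate $d$-simplex $K\subset\mathbb R^d$ (applied to each mesh element, where the objects carry a subscript $K$, and to $\hat K$, where the weights and test functions carry a hat and the matrices are written $G,C,\tilde C,M,\hat S$). Let $\lambda_0,\dots,\lambda_d$ be the barycentric coordinates and $F_j$ the face on which $\lambda_j=0$. $\mathbb P_k$ denotes polynomials of total degree at most $k$. $\Omega\in L^1(K)$ is a probability density, strictly positive a.e. in the interior of $K$; $\omega_j\in L^1(F_j)$ is the induced face density, i.e. the probability density, assumed to exist and to be positive a.e. on $F_j$, with $\int_{F_j}\phi\,\omega_j\,d\boldsymbol x=\lim_{\varepsilon\to0^+}\int_{\{\lambda_j<\varepsilon\}}\phi\,\Omega\,d\boldsymbol\sigma\big/\int_{\{\lambda_j<\varepsilon\}}\Omega\,d\boldsymbol\sigma$ for $\phi$ continuous on $F_j$ (evaluated near $F_j$ through a continuous extension).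 Set $\langle f,g\rangle_\Omega=\int_Kfg\,\Omega\,d\boldsymbol\sigma$, $\|f\|_\Omega^2=\langle f,f\rangle_\Omega$, $\langle f,g\rangle_{\omega_j}=\int_{F_j}fg\,\omega_j\,d\boldsymbol x$ (functions on $K$ restricted to $F_j$). Let $\mathbb S_2(K)=\{p\in\mathbb P_2(K):\langle p,\varphi\rangle_\Omega=0\ \forall\varphi\in\mathbb P_1(K)\}$ (dimension $d(d+1)/2$) and $\tilde d=(d-2)(d+1)/2$; $\rho_1,\dots,\rho_{\tilde d}\in\mathbb S_2(K)$ are linearly independent with span $\mathbb V$; $\psi_0,\dots,\psi_d\in\mathbb S_2(K)$ have span $\mathbb W$, with $\mathbb S_2(K)=\mathbb V\oplus\mathbb W$; $q_j\in\mathbb P_2(F_j)$ satisfies $\langle q_j,\varphi\rangle_{\omega_j}=0$ for all $\varphi\in\mathbb P_1(F_j)$. Functionals: $\mathcal L_j(f)=\langle f,q_j\rangle_{\omega_j}$, $\mathcal V_k(f)=\langle f,\rho_k\rangle_\Omega$. Local moment matrices: $[G]_{k\ell}=\mathcal V_k(\rho_\ell)$, $[C]_{ki}=\mathcal V_k(\psi_i)$, $[\tilde C]_{j\ell}=\mathcal L_j(\rho_\ell)$, $[M]_{ji}=\mathcal L_j(\psi_i)$, with $i,j=0,\dots,d$, $k,\ell=1,\dots,\tilde d$. $M$ is assumed invertible. The reduced stability matrix is $\hat S=G^{-1/2}SG^{-1/2}$ with $S=K_{11}-K_{12}K_{22}^{-1}K_{21}$ and $K_{11}=\tilde C^\top(M^\top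 M)\tilde C+G^3$, $K_{12}=\tilde C^\top(M^\top M)M+G^2C$, $K_{21}=M^\top(M^\top M)\tilde C+C^\top G^2$, $K_{22}=M^\top(M^\top M)M+C^\top GC$. The local inf--sup constant is $$\beta=\inf_{\substack{v\in\mathbb V\\ \|v\|_\Omega=1}}\ \inf_{w\in\mathbb W}\ \sup_{(\boldsymbol\eta,\boldsymbol\zeta)\neq\boldsymbol0}\frac{\sum_{j=0}^d\eta_j\mathcal L_j(v+w)+\sum_{k=1}^{\tilde d}\zeta_k\mathcal V_k(v+w)}{\big(\boldsymbol\eta^\top(M^\top M)^{-1}\boldsymbol\eta+\boldsymbol\zeta^\top G^{-1}\boldsymbol\zeta\big)^{1/2}},\qquad \boldsymbol\eta\in\mathbb R^{d+1},\ \boldsymbol\zeta\in\mathbb R^{\tilde d}.$$ *)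

(* Defs.v *)
From HB Require Import structures.
From mathcomp Require Import all_boot all_order all_algebra.
From mathcomp Require Import -(notations) mpoly.
From mathcomp Require Import all_classical all_reals all_analysis.
From mathcomp Require Import measurable_realfun.
Set Implicit Arguments.
Unset Strict Implicit.
Unset Printing Implicit Defensive.
Import Order.TTheory GRing.Theory Num.Theory.
Import numFieldNormedType.Exports.
Local Open Scope classical_set_scope.
Local Open Scope ring_scope.

(* Borel sigma-algebra of R^n (row vectors), generated by the coordinates *)
Definition rV_display : measure_display.
Proof. exact: (measure_tuple_display default_measure_display). Qed.

Section borel_rV.
Context {R : realType} (n : nat).

Definition rV_coord (i : 'I_n) (x : 'rV[R]_n) : R := x 0 i.

Let rV_set0 : g_sigma_preimage rV_coord set0.
Proof. exact: sigma_algebra0. Qed.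

Let rV_setC A : g_sigma_preimage rV_coord A -> g_sigma_preimage rV_coord (~` A).
Proof. exact: sigma_algebraC. Qed.

Let rV_bigcup (F : _^nat) : (forall i, g_sigma_preimage rV_coord (F i)) ->
  g_sigma_preimage rV_coord (\bigcup_i (F i)).
Proof. exact: sigma_algebra_bigcup. Qed.

HB.instance Definition _ := @isMeasurable.Build rV_display
  'rV[R]_n (g_sigma_preimage rV_coord) rV_set0 rV_setC rV_bigcup.

End borel_rV.

Section measurable_rV.
Context {R : realType}.

Lemma measurable_rV_coord n (i : 'I_n) :
  measurable_fun [set: 'rV[R]_n] (fun x : 'rV[R]_n => x 0 i).
Proof.
move=> _ Y mY; rewrite setTI; apply: sub_sigma_algebra => /=.
rewrite -bigcup_seq/=; exists i => /=; first by rewrite mem_index_enum.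
by exists Y => //; rewrite setTI.
Qed.

Lemma measurable_fun_rVP d (T : measurableType d) n (f : T -> 'rV[R]_n) :
  (forall i, measurable_fun [set: T] (fun x => f x 0 i)) ->
  measurable_fun [set: T] f.
Proof.
move=> mf.
have H : g_sigma_preimage (fun i => @rV_coord R n i \o f) `<=` measurable.
  apply: smallest_sub; first exact: sigma_algebra_measurable.
  move=> A; rewrite -bigcup_seq/= => -[i _ [B mB <-]].
  exact: mf.
move=> _ A mA; apply: H.
by rewrite g_sigma_preimage_comp; exists A.
Qed.

End measurable_rV.

Section lebesgue_rV.
Context {R : realType}.

Definition rV_cons n (z : measurableTypeR R * 'rV[R]_n) : 'rV[R]_n.+1 :=
  row_mx (z.1%:M : 'rV_1) z.2.

Definition rV_uncons n (x : 'rV[R]_n.+1) : measurableTypeR R * 'rV[R]_n :=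
  (x 0 0, \row_(i < n) x 0 (lift ord0 i)).

Lemma rV_cons0 n (z : measurableTypeR R * 'rV[R]_n) : rV_cons z 0 0 = z.1.
Proof.
have -> : (0 : 'I_n.+1) = lshift n (0 : 'I_1) by exact/val_inj.
by rewrite /rV_cons (@row_mxEl _ 1 1 n) mxE eqxx mulr1n.
Qed.

Lemma rV_consS n (z : measurableTypeR R * 'rV[R]_n) i : rV_cons z 0 (lift ord0 i) = z.2 0 i.
Proof.
have -> : lift ord0 i = rshift 1 i by exact/val_inj.
by rewrite /rV_cons (@row_mxEr _ 1 1 n).
Qed.

Lemma rV_consK n : cancel (@rV_cons n) (@rV_uncons n).
Proof.
case=> a v; rewrite /rV_uncons rV_cons0; congr pair.
by apply/rowP => i; rewrite mxE rV_consS.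
Qed.

Lemma rV_unconsK n : cancel (@rV_uncons n) (@rV_cons n).
Proof.
move=> x; apply/rowP => i; case: (unliftP ord0 i) => [j|] ->.
  by rewrite rV_consS mxE.
by rewrite [LHS]rV_cons0.
Qed.

Lemma measurable_rV_cons n : measurable_fun [set: measurableTypeR R * 'rV[R]_n] (@rV_cons n).
Proof.
apply: measurable_fun_rVP => i; case: (unliftP ord0 i) => [j|] ->.
  under eq_fun do rewrite rV_consS.
  exact: (measurableT_comp (measurable_rV_coord j) measurable_snd).
under eq_fun do rewrite rV_cons0.
exact: measurable_fst.
Qed.

Lemma measurable_rV_uncons n : measurable_fun [set: 'rV[R]_n.+1] (@rV_uncons n).
Proof.
apply: measurable_fun_pair; first exact: measurable_rV_coord.
apply: measurable_fun_rVP => i; under eq_fun do rewrite mxE.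
exact: measurable_rV_coord.
Qed.

(* the canonical instance of sigma-finiteness of a product measure is not found
   by unification, hence this restatement *)
Lemma prod_sigma_finite n (m : {sigma_finite_measure set 'rV[R]_n -> \bar R}) :
  sigma_finite setT ((@lebesgue_measure R) \x m)%E.
Proof.
have /sigma_finiteP[F [TF ndF Foo]] := sigma_finiteT (@lebesgue_measure R).
have /sigma_finiteP[G [TG ndG Goo]] := sigma_finiteT m.
exists (fun n => F n `*` G n).
  rewrite -setXTT TF TG predeqE => -[x y]; split.
    move=> [/= [i _ Fnx] [k _ Gky]]; exists (maxn i k) => //; split.
    - by move: x Fnx; exact/subsetPset/ndF/leq_maxl.
    - by move: y Gky; exact/subsetPset/ndG/leq_maxr.
  by move=> [i _ []/= ? ?]; split; exists i.
move=> k; have [? ?] := Foo k; have [? ?] := Goo k.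
split; first exact: measurableX.
by rewrite product_measure1E// lte_mul_pinfty// ge0_fin_numE.
Qed.

Section step.
Variables (n : nat) (m : {sigma_finite_measure set 'rV[R]_n -> \bar R}).

Definition leb_step : set 'rV[R]_n.+1 -> \bar R :=
  pushforward ((@lebesgue_measure R) \x m)%E (@rV_cons n).

HB.instance Definition _ := Measure.copy leb_step
  (measure_function_pushforward__canonical__measure_function_Measure
    ((@lebesgue_measure R) \x m)%E (@measurable_rV_cons n)).

Let leb_step_sigma_finite : sigma_finite setT leb_step.
Proof.
have [F FT mF] := prod_sigma_finite m.
exists (fun k => @rV_uncons n @^-1` F k).
  apply/seteqP; split => // x _.
  have : [set: _] (rV_uncons x) by [].
  by rewrite FT => -[k _ Fk]; exists k.
move=> k; have [mFk Foo] := mF k; split.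
  by rewrite -[X in measurable X]setTI; exact: measurable_rV_uncons.
rewrite /leb_step /pushforward -comp_preimage.
by rewrite (_ : rV_uncons (n:=n) \o rV_cons (n:=n) = id)//; apply/funext => z /=; rewrite rV_consK.
Qed.

HB.instance Definition _ :=
  Measure_isSigmaFinite.Build _ _ _ leb_step leb_step_sigma_finite.

End step.

(* Lebesgue measure on R^n: iterated product of the one-dimensional one;
   [leb_box] gives its value on boxes *)
Fixpoint leb (n : nat) : {sigma_finite_measure set 'rV[R]_n -> \bar R} :=
  if n is n'.+1 then leb_step (leb n') else \d_(0 : 'rV[R]_0).

Lemma leb_box n (a b : 'rV[R]_n) : (forall i, a 0 i <= b 0 i) ->
  leb n [set x | forall i, x 0 i \in `[a 0 i, b 0 i]] =
  (\prod_(i < n) (b 0 i - a 0 i))%:E.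
Proof.
elim: n a b => [|n IH] a b ab.
  rewrite big_ord0 /= diracE mem_set//=.
  by move=> [].
pose a' := (rV_uncons a).2; pose b' := (rV_uncons b).2.
rewrite -[LHS]/(((@lebesgue_measure R) \x leb n)%E (@rV_cons n @^-1` _)).
have -> : @rV_cons n @^-1` [set x | forall i, x 0 i \in `[a 0 i, b 0 i]] =
    `[a 0 0, b 0 0]%classic `*`
    [set x : 'rV_n | forall i, x 0 i \in `[a' 0 i, b' 0 i]].
  apply/seteqP; split => -[x v] /=.
    move=> H; split; first by have := H 0; rewrite [rV_cons _ _ _]rV_cons0.
    by move=> i; have := H (lift ord0 i); rewrite rV_consS !mxE.
  move=> [H0 HS] i; case: (unliftP ord0 i) => [j|] ->.
    by rewrite rV_consS; have := HS j; rewrite !mxE.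
  by rewrite [rV_cons _ _ _]rV_cons0.
have mB : measurable [set x : 'rV[R]_n | forall i, x 0 i \in `[a' 0 i, b' 0 i]].
  rewrite (_ : [set x | _] = \big[setI/setT]_(i < n)
      ((fun x : 'rV[R]_n => x 0 i) @^-1` `[a' 0 i, b' 0 i])).
    apply: bigsetI_measurable => i _.
    by rewrite -[X in measurable X]setTI; exact: measurable_rV_coord.
  rewrite -bigcap_seq; apply/seteqP; split => x /= H i => [_|]; first exact: H.
  by apply: H; rewrite /= mem_index_enum.
rewrite product_measure1E//= lebesgue_measure_itv/= IH; last first.
  by move=> i; rewrite !mxE.
rewrite big_ord_recl /= EFinM; congr (_ * _)%E; last first.
  by congr EFin; apply: eq_bigr => i _; rewrite !mxE.
rewrite lte_fin; case: ltP => // ba.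
by rewrite (@le_anti _ _ (a 0 ord0) (b 0 ord0)) ?subrr// ab.
Qed.

End lebesgue_rV.

Section simplices.
Context {R : realType}.

(* a simplex is given by the matrix whose rows are its vertices *)
Definition simplex k d (P : 'M[R]_(k.+1, d)) : set 'rV[R]_d :=
  [set x | exists t : 'rV[R]_k.+1,
     [/\ forall i, 0 <= t 0 i, \sum_i t 0 i = 1 & x = t *m P]].

Definition edges k d (P : 'M[R]_(k.+1, d)) : 'M[R]_(k, d) :=
  \matrix_(i < k) (row (lift ord0 i) P - row ord0 P).

Definition nondegenerate k d (P : 'M[R]_(k.+1, d)) : Prop := row_free (edges P).

(* barycentric coordinates: the solution l of (1, x) = l *m (1, P),
   i.e. of \sum_j l_j = 1 and \sum_j l_j P_j = x *)
Definition bary d (P : 'M[R]_(d.+1, d)) (x : 'rV[R]_d) : 'rV[R]_d.+1 :=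
  (row_mx (const_mx 1 : 'rV[R]_1) x : 'rV[R]_(1 + d)) *m
  invmx (row_mx (const_mx 1 : 'cV[R]_(d.+1)) P : 'M[R]_(d.+1, 1 + d)).

Definition face d (P : 'M[R]_(d.+1, d)) (j : 'I_(d.+1)) : set 'rV[R]_d :=
  [set x | simplex P x /\ bary P x 0 j = 0].

Definition std_simplex k : set 'rV[R]_k :=
  [set y | (forall i, 0 <= y 0 i) /\ \sum_i y 0 i <= 1].

Definition param k d (P : 'M[R]_(k.+1, d)) (y : 'rV[R]_k) : 'rV[R]_d :=
  row ord0 P + y *m edges P.

Lemma measurable_std_simplex k : measurable (@std_simplex k).
Proof.
have -> : @std_simplex k =
    (\big[setI/setT]_(i < k) ((fun y : 'rV[R]_k => y 0 i) @^-1` `[0, +oo[)) `&`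
    ((fun y : 'rV[R]_k => \sum_i y 0 i) @^-1` `]-oo, 1]).
  rewrite -bigcap_seq; apply/seteqP; split => y /= [y0 y1]; split.
  - by move=> i _ /=; rewrite in_itv/= andbT.
  - by rewrite in_itv.
  - move=> i; have /= := y0 i; rewrite in_itv/= andbT; apply.
    by rewrite mem_index_enum.
  - by move: y1; rewrite in_itv.
apply: measurableI.
  apply: bigsetI_measurable => i _.
  by rewrite -[X in measurable X]setTI; exact: measurable_rV_coord.
rewrite -[X in measurable X]setTI.
have mS : measurable_fun [set: 'rV[R]_k] (fun y : 'rV[R]_k => \sum_i y 0 i).
  by apply: measurable_sum => i; exact: measurable_rV_coord.
exact: mS.
Qed.

Lemma measurable_param k d (P : 'M[R]_(k.+1, d)) :
  measurable_fun [set: 'rV[R]_k] (param P).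
Proof.
apply: measurable_fun_rVP => j.
have -> : (fun y => param P y 0 j) =
    (fun y => row ord0 P 0 j + \sum_i y 0 i * edges P i j).
  by apply/funext => y; rewrite mxE [X in _ + X]mxE.
apply: measurable_funD => //; apply: measurable_sum => i.
by apply: measurable_funM => //; exact: measurable_rV_coord.
Qed.

(* k-dimensional surface measure on the k-simplex with vertices P, by the area
   formula for its affine parametrization with Jacobian matrix J := edges P:
   image under param P of the Lebesgue measure on the standard simplex, scaled
   by the Gram factor sqrt (det (J J^T)) *)
Definition surface_measure k d (P : 'M[R]_(k.+1, d)) :
    set 'rV[R]_d -> \bar R :=
  pushforward
    (mscale (Num.sqrt (\det (edges P *m (edges P)^T)))%:nng
       (mrestr (leb k) (@measurable_std_simplex k)))
    (param P).

HB.instance Definition _ k d (P : 'M[R]_(k.+1, d)) :=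
  Measure.copy (surface_measure P)
    (measure_function_pushforward__canonical__measure_function_Measure
      (mscale (Num.sqrt (\det (edges P *m (edges P)^T)))%:nng
        (mrestr (leb k) (@measurable_std_simplex k)))
      (@measurable_param k d P)).

Definition face_measure n (P : 'M[R]_(n.+2, n.+1)) (j : 'I_(n.+2)) :
    {measure set 'rV[R]_n.+1 -> \bar R} :=
  surface_measure (row' j P : 'M[R]_(n.+1, n.+1)).

End simplices.

Arguments std_simplex {R} k _.

(* (d - 2)(d + 1) / 2, meant for d >= 2 *)
Definition tdim (d : nat) : nat := ((d - 2) * d.+1)./2.

(* Local data on a simplex of dimension d = n.+1.  Functions on K and on its
   faces are represented by functions on the whole space, of which only the
   restrictions are ever used; polynomials are formal ones, so that P_k(K) is
   [msize p <= k.+1] (msize is the total degree plus one) and an element of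
   P_k(F_j) is the restriction of such a polynomial to F_j. *)
Record local_data (R : realType) (n : nat) := LocalData {
  vtx : 'M[R]_(n.+2, n.+1);
  Om : 'rV[R]_n.+1 -> R;
  om : 'I_(n.+2) -> 'rV[R]_n.+1 -> R;
  rho : 'I_(tdim n.+1) -> mpoly n.+1 R;
  psi : 'I_(n.+2) -> mpoly n.+1 R;
  q : 'I_(n.+2) -> mpoly n.+1 R }.

Section local_setting.
Context {R : realType} {n : nat}.
Implicit Types (D : local_data R n) (p v w : mpoly n.+1 R).

Definition pfun p (x : 'rV[R]_n.+1) : R := meval (fun i => x 0 i) p.

Definition elt D : set 'rV[R]_n.+1 := simplex (vtx D).
Definition fac D (j : 'I_(n.+2)) : set 'rV[R]_n.+1 := face (vtx D) j.
Definition surf D j : {measure set 'rV[R]_n.+1 -> \bar R} :=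
  face_measure (vtx D) j.

Definition dotOm D (f g : 'rV[R]_n.+1 -> R) : R :=
  \int[leb n.+1]_(x in elt D) (f x * g x * Om D x).
Definition normOm D f : R := Num.sqrt (dotOm D f f).
Definition dotom D j (f g : 'rV[R]_n.+1 -> R) : R :=
  \int[surf D j]_(x in fac D j) (f x * g x * om D j x).

Definition is_density (mu : {measure set 'rV[R]_n.+1 -> \bar R})
    (A : set 'rV[R]_n.+1) (f : 'rV[R]_n.+1 -> R) : Prop :=
  [/\ mu.-integrable A (EFin \o f),
      {ae mu, forall x, A x -> 0 <= f x} &
      (\int[mu]_(x in A) (f x)%:E = 1)%E].

Definition layer D j (eps : R) : set 'rV[R]_n.+1 :=
  [set x | elt D x /\ bary (vtx D) x 0 j < eps].

(* [phi] plays both the role of the continuous function on F_j and of its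
   continuous extension to K *)
Definition induced_face_density D j : Prop :=
  forall phi : 'rV[R]_n.+1 -> R, {within elt D, continuous phi} ->
    (\int[leb n.+1]_(x in layer D j eps) (phi x * Om D x) /
     \int[leb n.+1]_(x in layer D j eps) Om D x) @[eps --> 0^'+] -->
    \int[surf D j]_(x in fac D j) (phi x * om D j x).

Definition S2 D p : Prop :=
  (msize p <= 3)%N /\
  forall phi : mpoly n.+1 R, (msize phi <= 2)%N ->
    dotOm D (pfun p) (pfun phi) = 0.

Definition inV D v : Prop :=
  exists a : 'I_(tdim n.+1) -> R, v = \sum_k a k *: rho D k.
Definition inW D w : Prop :=
  exists b : 'I_(n.+2) -> R, w = \sum_i b i *: psi D i.

Definition Lfun D j (f : 'rV[R]_n.+1 -> R) : R := dotom D j f (pfun (q D j)).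
Definition Vfun D k (f : 'rV[R]_n.+1 -> R) : R := dotOm D f (pfun (rho D k)).

Definition Gmx D : 'M[R]_(tdim n.+1) :=
  \matrix_(k, l) Vfun D k (pfun (rho D l)).
Definition Cmx D : 'M[R]_(tdim n.+1, n.+2) :=
  \matrix_(k, i) Vfun D k (pfun (psi D i)).
Definition Ctmx D : 'M[R]_(n.+2, tdim n.+1) :=
  \matrix_(j, l) Lfun D j (pfun (rho D l)).
Definition Mmx D : 'M[R]_(n.+2) :=
  \matrix_(j, i) Lfun D j (pfun (psi D i)).

Definition local_setting D : Prop :=
  [/\ nondegenerate (vtx D),
      is_density (leb n.+1) (elt D) (Om D),
      {ae leb n.+1, forall x, (elt D)° x -> 0 < Om D x} &
      forall j, [/\ is_density (surf D j) (fac D j) (om D j),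
                    {ae surf D j, forall x, fac D j x -> 0 < om D j x} &
                    induced_face_density D j]] /\
  [/\ forall k, S2 D (rho D k),
      forall a : 'I_(tdim n.+1) -> R,
        \sum_k a k *: rho D k = 0 -> forall k, a k = 0,
      forall i, S2 D (psi D i),
      forall p, S2 D p -> exists v w, [/\ inV D v, inW D w & p = v + w] &
      forall p, inV D p -> inW D p -> p = 0] /\
  (forall j, (msize (q D j) <= 3)%N /\
     forall phi : mpoly n.+1 R, (msize phi <= 2)%N ->
       dotom D j (pfun (q D j)) (pfun phi) = 0) /\
  Mmx D \in unitmx.

Definition spd m (A : 'M[R]_m) : Prop :=
  A^T = A /\ forall x : 'cV[R]_m, x != 0 -> 0 < (x^T *m A *m x) 0 0.

(* A^{-1/2}: for A symmetric positive definite, the unique X in this set *)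
Definition invsqrtmx m (A : 'M[R]_m) : 'M[R]_m :=
  xget 0 [set X | spd X /\ X *m X = invmx A].

Definition K11 D := (Ctmx D)^T *m ((Mmx D)^T *m Mmx D) *m Ctmx D
                    + Gmx D *m Gmx D *m Gmx D.
Definition K12 D := (Ctmx D)^T *m ((Mmx D)^T *m Mmx D) *m Mmx D
                    + Gmx D *m Gmx D *m Cmx D.
Definition K21 D := (Mmx D)^T *m ((Mmx D)^T *m Mmx D) *m Ctmx D
                    + (Cmx D)^T *m (Gmx D *m Gmx D).
Definition K22 D := (Mmx D)^T *m ((Mmx D)^T *m Mmx D) *m Mmx D
                    + (Cmx D)^T *m Gmx D *m Cmx D.
Definition Smx D : 'M[R]_(tdim n.+1) := K11 D - K12 D *m invmx (K22 D) *m K21 D.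
Definition Shat D : 'M[R]_(tdim n.+1) :=
  invsqrtmx (Gmx D) *m Smx D *m invsqrtmx (Gmx D).

Definition infsup_quotient D (f : 'rV[R]_n.+1 -> R)
    (eta : 'cV[R]_n.+2) (zeta : 'cV[R]_(tdim n.+1)) : R :=
  (\sum_j eta j 0 * Lfun D j f + \sum_k zeta k 0 * Vfun D k f) /
  Num.sqrt ((eta^T *m invmx ((Mmx D)^T *m Mmx D) *m eta) 0 0
            + (zeta^T *m invmx (Gmx D) *m zeta) 0 0).

(* extended-real valued, so that the infimum over an empty unit sphere
   (tdim d = 0, i.e. d = 2) is +oo *)
Definition infsup D : \bar R :=
  ereal_inf [set
    ereal_inf [set
      ereal_sup [set (infsup_quotient D (pfun (v + w)) z.1 z.2)%:E
        | z in [set z : 'cV[R]_n.+2 * 'cV[R]_(tdim n.+1) | z != 0]]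
      | w in [set w | inW D w]]
    | v in [set v | inV D v /\ normOm D (pfun v) = 1]].

End local_setting.

(* a finite family of simplices with pairwise disjoint interiors *)
Definition simplicial_mesh (R : realType) (d : nat) (T : finType)
    (P : T -> 'M[R]_(d.+1, d)) : Prop :=
  (forall K, nondegenerate (P K)) /\
  (forall K K', K != K' -> (simplex (P K))° `&` (simplex (P K'))° = set0).

Definition affine_map (R : realType) (d : nat) (f : 'rV[R]_d -> 'rV[R]_d) :=
  exists (A : 'M[R]_d) (b : 'rV[R]_d), forall x, f x = x *m A + b.

(* Main.v *)
(* By conditions (1)-(3) every entry of the moment matrices is an integral
   transported unchanged by the affine map.  The reduced stability matrix is by
   definition a function of the moment matrices, and so is the inf-sup constant:
   for v = sum_k a_k rho_k and w = sum_i b_i psi_i, linearity gives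
   L(v + w) = Ct a + M b, V(v + w) = G a + C b and |v|^2 = a^T G a.
   The supremum of the quotient is at least the square root of
   N(a, b) = |M (Ct a + M b)|^2 + (G a + C b)^T G (G a + C b), the quadratic form
   with blocks K11, K12, K21, K22 at (a, b).  Minimizing over b leaves the Schur
   complement, N(a, b) >= a^T S a, and the positive definiteness of
   G^(-1/2) S G^(-1/2) yields c > 0 with a^T S a >= c a^T G a = c |v|^2.  Hence
   beta >= sqrt c. *)
Require Import Defs.
From HB Require Import structures.
From mathcomp Require Import all_boot all_order all_algebra.
From mathcomp Require Import -(notations) mpoly.
From mathcomp Require Import all_classical all_reals all_analysis.
From mathcomp Require Import measurable_realfun ring lra.
Set Implicit Arguments.
Unset Strict Implicit.
Unset Printing Implicit Defensive.
Import Order.TTheory GRing.Theory Num.Theory.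
Import numFieldNormedType.Exports.
Local Open Scope classical_set_scope.
Local Open Scope ring_scope.

(** * Quadratic forms: coercivity, Schur complements and inverse square roots *)

Section quadratic_forms.
Context {R : realType}.

Definition qform m (A : 'M[R]_m) (x : 'cV[R]_m) : R := (x^T *m A *m x) 0 0.

Lemma spd_ge0 m (A : 'M[R]_m) x : spd A -> 0 <= qform A x.
Proof.
move=> [_ Apos]; have [->|/Apos/ltW//] := eqVneq x 0.
by rewrite /qform mulmx0 mxE.
Qed.

Lemma spd_unitmx m (A : 'M[R]_m) : spd A -> A \in unitmx.
Proof.
move=> [_ Apos]; rewrite unitmxE unitfE; apply/negP => /det0P[v v0 vA].
have /Apos : v^T != 0 by rewrite -(inj_eq trmx_inj) trmxK trmx0.
by rewrite trmxK vA mul0mx mxE ltxx.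
Qed.

Lemma qform1E m (x : 'cV[R]_m) : qform 1%:M x = \sum_i x i 0 ^+ 2.
Proof.
by rewrite /qform mulmx1 mxE; apply: eq_bigr => i _; rewrite mxE expr2.
Qed.

Lemma qform1_gt0 m (x : 'cV[R]_m) : x != 0 -> 0 < qform 1%:M x.
Proof.
move=> x0; rewrite qform1E lt0r sumr_ge0 ?andbT; last by move=> i _; exact: sqr_ge0.
apply: contra x0; rewrite psumr_eq0; last by move=> i _; exact: sqr_ge0.
move=> /allP xi0; apply/eqP/matrixP => i j; rewrite mxE ord1.
by have := xi0 i (mem_index_enum _); rewrite sqrf_eq0 => /eqP.
Qed.

Lemma qform_le m (A : 'M[R]_m) x :
  qform A x <= (\sum_i \sum_j `|A i j|) * qform 1%:M x.
Proof.
have -> : qform A x = \sum_i \sum_j x i 0 * A i j * x j 0.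
  rewrite /qform -mulmxA mxE; apply: eq_bigr => i _; rewrite !mxE mulr_sumr.
  by apply: eq_bigr => j _; rewrite mulrA.
rewrite mulr_suml; apply: ler_sum => i _; rewrite mulr_suml.
apply: ler_sum => j _; rewrite qform1E.
have sqr_le k : x k 0 ^+ 2 <= \sum_i x i 0 ^+ 2.
  by rewrite (bigD1 k)//= lerDl sumr_ge0// => l _; exact: sqr_ge0.
apply: (le_trans (ler_norm _)); rewrite mulrAC mulrC normrM.
apply: ler_wpM2l => //.
(* Both bounds on [x i 0 * x j 0] come from the nonnegativity of the squares of the sum and the
   difference of the two entries. *)
rewrite ler_norml; have := sqr_le i; have := sqr_le j.
have := sqr_ge0 (x i 0 - x j 0); have := sqr_ge0 (x i 0 + x j 0).
by rewrite !expr2 => *; apply/andP; split; nra.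
Qed.

(** A 1 x 1 matrix equals its transpose. *)
Lemma bform_sym m p (A : 'M[R]_(m, p)) x y :
  x^T *m A *m y = y^T *m A^T *m x :> 'M[R]_1.
Proof.
rewrite -[x in RHS]trmxK -mulmxA -!trmx_mul.
by apply/matrixP => i j; rewrite [RHS]mxE !ord1.
Qed.

Lemma qformB m (A : 'M[R]_m) x y : A^T = A ->
  qform A (x - y) = qform A x - 2 * (y^T *m A *m x) 0 0 + qform A y.
Proof.
move=> As; rewrite /qform [(x - y)^T]linearB /= !(mulmxBl, mulmxBr).
by rewrite (bform_sym A x y) As !mxE; ring.
Qed.

(* With [B = A^-1] and [b] a bound for [B], expand the nonnegative quantity
   [qform A (x - b^-1 B x)]. *)
Lemma spd_coercive m (A : 'M[R]_m) : spd A ->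
  exists2 c, 0 < c & forall x, c * qform 1%:M x <= qform A x.
Proof.
move=> Aspd; have Au := spd_unitmx Aspd; have [As _] := Aspd.
set B := invmx A; pose b := 1 + \sum_i \sum_j `|B i j|.
(* The summand 1 in [b] keeps it positive even when [m = 0]. *)
have b_gt0 : 0 < b by rewrite ltr_pwDl// sumr_ge0// => i _; rewrite sumr_ge0.
exists b^-1; first by rewrite invr_gt0.
move=> x; have := spd_ge0 (x - b^-1 *: (B *m x)) Aspd.
have Bs : B^T = B by rewrite trmx_inv As.
have qB : qform A (b^-1 *: (B *m x)) = b^-1 ^+ 2 * qform B x.
  rewrite /qform [(_ *: _)^T]linearZ /= trmx_mul Bs -!(scalemxAl, scalemxAr) scalerA.
  by rewrite mxE -expr2 !mulmxA mulmxKV.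
have cross : ((b^-1 *: (B *m x))^T *m A *m x) 0 0 = b^-1 * qform 1%:M x.
  by rewrite /qform [(_ *: _)^T]linearZ /= trmx_mul Bs -!scalemxAl mxE mulmxKV// mulmx1.
rewrite qformB// qB cross.
have q0 : 0 <= qform 1%:M x.
  by have [->|/qform1_gt0/ltW//] := eqVneq x 0; rewrite /qform mulmx0 mxE.
(* By [qform_le] the last term of the expansion is at most half of the cross term, which leaves
   [b^-1 * qform 1%:M x]. *)
have : b^-1 ^+ 2 * qform B x <= b^-1 * qform 1%:M x.
  rewrite expr2 -mulrA ler_pM2l ?invr_gt0// mulrC ler_pdivrMr//.
  by rewrite (le_trans (qform_le B x))// mulrC ler_wpM2l// lerDr.
lra.
Qed.

Lemma qformM m p (A : 'M[R]_m) (B : 'M[R]_(m, p)) x :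
  qform A (B *m x) = qform (B^T *m A *m B) x.
Proof. by rewrite /qform trmx_mul !mulmxA. Qed.

Lemma mulmx_unit_neq0 m (A : 'M[R]_m) (x : 'cV[R]_m) :
  A \in unitmx -> x != 0 -> A *m x != 0.
Proof.
by move=> Au; apply: contra => /eqP Ax0; rewrite -(mulKmx Au x) Ax0 mulmx0.
Qed.

(* Completing the square in [y]: the difference of the two sides is
   [qform D (y + D^-1 B^T x)]. *)
Lemma schur_complement_le m p (A : 'M[R]_m) (B : 'M[R]_(m, p)) (D : 'M[R]_p)
    x y : spd D ->
  qform (A - B *m invmx D *m B^T) x <=
  qform A x + 2 * (y^T *m B^T *m x) 0 0 + qform D y.
Proof.
move=> Dspd; have Du := spd_unitmx Dspd; have [Ds _] := Dspd.
(* The sum is written as a difference so that [qformB] expands it. *)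
have := spd_ge0 (y - - (invmx D *m (B^T *m x))) Dspd.
rewrite qformB// [in X in _ - 2 * X]bform_sym Ds.
rewrite mulmxN [in X in _ - 2 * X]mxE -(mulmxA _ D) mulKVmx//.
have -> : qform D (- (invmx D *m (B^T *m x))) =
    qform (B *m invmx D *m B^T) x.
  rewrite /qform [(- _)^T]linearN /= !mulNmx mulmxN opprK !trmx_mul trmxK trmx_inv Ds.
  by rewrite !mulmxA mulmxKV.
have -> : qform (A - B *m invmx D *m B^T) x =
    qform A x - qform (B *m invmx D *m B^T) x.
  by rewrite /qform mulmxBr mulmxBl !mxE.
by rewrite mulmxA; lra.
Qed.

(** Here A is the square of X^-1, so x^T A x is the squared Euclidean norm of X^-1 x. *)
Lemma sqrtmx_spd m (A X : 'M[R]_m) : spd X -> X *m X = invmx A ->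
  [/\ A \in unitmx, spd A & A = invmx X *m invmx X].
Proof.
move=> Xspd XX; have Xu := spd_unitmx Xspd; have [Xs _] := Xspd.
(* [invmx] returns a singular matrix unchanged, so invertibility of [invmx A] gives that of [A]. *)
have Au : A \in unitmx by rewrite -unitmx_inv -XX unitmx_mul Xu.
have AE : A = invmx X *m invmx X.
  by rewrite -[RHS](mulKVmx Au) -XX !mulmxA !mulmxK.
split => //; split=> [|x x0].
  by rewrite AE trmx_mul trmx_inv Xs.
have X'u : invmx X \in unitmx by rewrite unitmx_inv.
have := qform1_gt0 (mulmx_unit_neq0 X'u x0).
by rewrite qformM mulmx1 trmx_inv Xs -AE.
Qed.

(* Shared by the two possible values of [invsqrtmx G]: a square root of
   [G^-1], or the junk value [0], whose positive definiteness forces [m = 0]. *)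
Lemma spd_invsqrtmx_congr m (G S : 'M[R]_m) :
  spd (invsqrtmx G *m S *m invsqrtmx G) ->
  spd G /\ exists2 c, 0 < c & forall x, c * qform G x <= qform S x.
Proof.
rewrite /invsqrtmx; case: xgetP => [X _ [Xspd XX]|_]; last first.
  rewrite mul0mx mulmx0 => -[_ pos0].
  have x0 (x : 'cV[R]_m) : x = 0.
    by apply/eqP/negPn/negP => /pos0; rewrite mulmx0 mul0mx mxE ltxx.
  have A0 (A : 'M[R]_m) : A = 0.
    by apply/matrixP => i j; have /matrixP/(_ i 0) := x0 (col j A); rewrite !mxE.
  split; first by split=> [|x]; [rewrite (A0 G) trmx0|rewrite (x0 x) eqxx].
  by exists 1 => // x; rewrite (x0 x) /qform !mulmx0 mxE mulr0.
have [Gu Gspd GE] := sqrtmx_spd Xspd XX; have Xu := spd_unitmx Xspd.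
have [Xs _] := Xspd.
move=> /spd_coercive[c c0 cP]; split=> //; exists c => // x.
(* At X^-1 x the squared Euclidean norm becomes x^T G x, and the outer factors X of the congruence
   cancel. *)
have := cP (invmx X *m x); rewrite !qformM mulmx1 trmx_inv Xs -GE.
by rewrite !mulmxA mulVmx// mul1mx mulmxK.
Qed.

End quadratic_forms.

(** * The inf-sup constant as a function of four matrices *)

Section moment_matrices.
Context {R : realType} {m p : nat}.
Variables (G : 'M[R]_m) (C : 'M[R]_(m, p)) (Ct : 'M[R]_(p, m)) (M : 'M[R]_p).

(** The four blocks for arbitrary matrices. At the moment matrices of local data they are
    convertible to [K11], [K12], [K21], [K22], so hypotheses on [Shat] apply to them directly. *)
Definition mxK11 := Ct^T *m (M^T *m M) *m Ct + G *m G *m G.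
Definition mxK12 := Ct^T *m (M^T *m M) *m M + G *m G *m C.
Definition mxK21 := M^T *m (M^T *m M) *m Ct + C^T *m (G *m G).
Definition mxK22 := M^T *m (M^T *m M) *m M + C^T *m G *m C.

(** The form at x is |M M x|^2 + (C x)^T G (C x); the first term is positive because M is
    invertible. *)
Lemma mxK22_spd : spd G -> M \in unitmx -> spd mxK22.
Proof.
move=> Gspd Mu; have [Gs _] := Gspd; split=> [|x x0].
  by rewrite /mxK22 [(_ + _)^T]linearD /= !trmx_mul !trmxK Gs !mulmxA.
rewrite /mxK22 mulmxDr mulmxDl mxE ltr_pwDl//.
  have := qform1_gt0 (mulmx_unit_neq0 Mu (mulmx_unit_neq0 Mu x0)).
  by rewrite !qformM mulmx1 /qform !mulmxA.
have := spd_ge0 (C *m x) Gspd.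
by rewrite qformM.
Qed.

(** The right-hand side expands to the quadratic form with blocks [mxK11], [mxK12], [mxK21], [mxK22]
    at (a, b); the left-hand side is its minimum over b. *)
Lemma reduced_stability_le a b : spd G -> M \in unitmx ->
  qform (mxK11 - mxK12 *m invmx mxK22 *m mxK21) a <=
  qform (M^T *m M) (Ct *m a + M *m b) + qform G (G *m a + C *m b).
Proof.
move=> Gspd Mu; have [Gs _] := Gspd.
have K21E : mxK21 = mxK12^T.
  by rewrite /mxK21 /mxK12 [(_ + _)^T]linearD /= !trmx_mul !trmxK Gs !mulmxA.
rewrite K21E.
apply: (le_trans (schur_complement_le mxK11 mxK12 a b (mxK22_spd Gspd Mu))).
have Qs : (M^T *m M)^T = M^T *m M by rewrite trmx_mul trmxK.
(* A double negation turns each sum into a difference, the form that [qformB] expands. *)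
rewrite -[M *m b]opprK -[C *m b]opprK !qformB//.
rewrite -K21E /mxK11 /mxK21 /mxK22 /qform.
rewrite ![(- _)^T]linearN /= !(mulmxN, mulNmx) !trmx_mul Gs.
rewrite !(mulmxDr, mulmxDl) !mulmxA.
rewrite !mxE.
lra.
Qed.

(** [l] and [g] stand for the vectors of values of the functionals L_j and V_k. *)
Definition mx_quotient (l : 'cV[R]_p) (g : 'cV[R]_m) eta zeta : R :=
  ((eta^T *m l) 0 0 + (zeta^T *m g) 0 0) /
  Num.sqrt (qform (invmx (M^T *m M)) eta + qform (invmx G) zeta).

(** The equality case of Cauchy-Schwarz, eta = M^T M l and zeta = G g, makes the numerator and the
    radicand both equal to N, so the quotient is N / sqrt N. *)
Lemma mx_quotient_sup l g (N := qform (M^T *m M) l + qform G g) :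
  spd G -> M \in unitmx -> 0 < N ->
  ((Num.sqrt N)%:E <= ereal_sup [set (mx_quotient l g z.1 z.2)%:E
     | z in [set z : 'cV[R]_p * 'cV[R]_m | z != 0%R]])%E.
Proof.
move=> Gspd Mu N0; have [Gs _] := Gspd; have Gu := spd_unitmx Gspd.
have Qu : M^T *m M \in unitmx by rewrite unitmx_mul unitmx_tr Mu.
apply: ereal_sup_ubound; exists (M^T *m M *m l, G *m g) => /=.
  (* If this pair vanished, N would be 0. *)
  apply/eqP => -[Ql Gg]; move: N0; rewrite /N /qform -!mulmxA.
  by rewrite (mulmxA M^T) Ql Gg !mulmx0 !mxE addr0 ltxx.
congr EFin; rewrite /mx_quotient !qformM !trmx_mul trmxK Gs.
rewrite !mulmxV// !mul1mx -/(qform _ l) -/(qform _ g) -/N.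
by rewrite -{1}(sqr_sqrtr (ltW N0)) expr2 mulfK// sqrtr_eq0 -ltNge.
Qed.

Definition mx_infsup : \bar R :=
  ereal_inf [set
    ereal_inf [set
      ereal_sup [set (mx_quotient (Ct *m a + M *m b) (G *m a + C *m b)
                        z.1 z.2)%:E
        | z in [set z : 'cV[R]_p * 'cV[R]_m | z != 0]]
      | b in [set: 'cV[R]_p]]
    | a in [set a | qform G a = 1]].

Lemma mx_infsup_gt0 : M \in unitmx ->
  spd (invsqrtmx G *m (mxK11 - mxK12 *m invmx mxK22 *m mxK21) *m invsqrtmx G) ->
  (0 < mx_infsup)%E.
Proof.
move=> Mu /spd_invsqrtmx_congr[Gspd [c c0 cP]].
(* Strict positivity need not survive an infimum, hence the bound sqrt c, uniform in a and b. *)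
apply: (@lt_le_trans _ _ (Num.sqrt c)%:E); first by rewrite lte_fin sqrtr_gt0.
apply: le_ereal_inf_tmp => _ [a /= a1 <-].
apply: le_ereal_inf_tmp => _ [b _ <-].
have cN : c <= qform (M^T *m M) (Ct *m a + M *m b) + qform G (G *m a + C *m b).
  by have := cP a; rewrite a1 mulr1 => /le_trans; apply; exact: reduced_stability_le.
apply: le_trans (mx_quotient_sup Gspd Mu (lt_le_trans c0 cN)).
by rewrite lee_fin ler_sqrt// ltW// (lt_le_trans c0).
Qed.

End moment_matrices.

(** * Simplices and faces: measurability, boundedness, finite measure *)

Section simplex_measurability.
Context {R : realType}.

(** Dropping the zeroth barycentric coordinate is an affine change of variables onto the standard
    simplex, from which measurability is pulled back. *)
Lemma simplex_std d (P : 'M[R]_(d.+1, d)) : Defs.nondegenerate P ->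
  simplex P = [set x | std_simplex d ((x - row ord0 P) *m invmx (edges P))].
Proof.
rewrite /Defs.nondegenerate row_free_unit => Eu.
have affine_comb (t : 'rV[R]_d.+1) : \sum_i t 0 i = 1 ->
    t *m P = row ord0 P + (\row_i t 0 (lift ord0 i)) *m edges P.
  move=> t1; apply/rowP => k; rewrite !mxE big_ord_recl.
  have -> : t 0 ord0 = 1 - \sum_i t 0 (lift ord0 i).
    by rewrite -t1 big_ord_recl addrK.
  rewrite mulrBl mul1r mulr_suml -addrA -sumrN -big_split /=; congr (_ + _).
  by apply: eq_bigr => i _; rewrite !mxE; ring.
apply/seteqP; split => [x [t [t0 t1 ->]]|x [/= y0 y1]].
  rewrite /= affine_comb// addrC addKr mulmxK//; split => [i|].
    by rewrite mxE.
  under eq_bigr do rewrite mxE.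
  by rewrite -t1 big_ord_recl lerDr.
set y := (x - row ord0 P) *m invmx (edges P) in y0 y1.
(* The dropped coordinate is recovered as one minus the sum of the others. *)
pose t : 'rV[R]_d.+1 :=
  \row_i (if unlift ord0 i is Some j then y 0 j else 1 - \sum_j y 0 j).
have tS : \row_i t 0 (lift ord0 i) = y by apply/rowP => i; rewrite 2!mxE liftK.
have t1 : \sum_i t 0 i = 1.
  rewrite big_ord_recl mxE unlift_none.
  by under [X in _ + X]eq_bigr do rewrite mxE liftK; rewrite subrK.
exists t; split => //.
  by move=> i; rewrite mxE; case: unliftP => [j _|_]; rewrite ?subr_ge0.
by rewrite affine_comb// tS mulmxKV// addrC subrK.
Qed.

Lemma measurable_fun_mulmxr d n p (T : measurableType d) (f : T -> 'rV[R]_n)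
    (A : 'M[R]_(n, p)) :
  measurable_fun [set: T] f -> measurable_fun [set: T] (fun x => f x *m A).
Proof.
move=> mf; apply: measurable_fun_rVP => j; under eq_fun do rewrite mxE.
apply: measurable_sum => i; apply: measurable_funM => //.
exact: (measurableT_comp (measurable_rV_coord i) mf).
Qed.

Lemma measurable_simplex d (P : 'M[R]_(d.+1, d)) : Defs.nondegenerate P ->
  measurable (simplex P).
Proof.
move=> /simplex_std ->; rewrite -[X in measurable X]setTI.
have mf : measurable_fun [set: 'rV[R]_d] (fun x : 'rV[R]_d => x - row ord0 P).
  apply: measurable_fun_rVP => i; under eq_fun do rewrite mxE.
  by apply: measurable_funD => //; exact: measurable_rV_coord.
have := measurable_fun_mulmxr (invmx (edges P)) mf.
by move=> /(_ measurableT _ (@measurable_std_simplex R d)).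
Qed.

Lemma measurable_bary d (P : 'M[R]_(d.+1, d)) i :
  measurable_fun [set: 'rV[R]_d] (fun x => bary P x 0 i).
Proof.
apply: (measurableT_comp (measurable_rV_coord i)).
apply: (@measurable_fun_mulmxr _ (1 + d) d.+1).
apply: measurable_fun_rVP => j; under eq_fun do rewrite mxE.
case: splitP => k _; under eq_fun do rewrite ?mxE//.
  exact: measurable_cst.
exact: measurable_rV_coord.
Qed.

Lemma measurable_face d (P : 'M[R]_(d.+1, d)) j : Defs.nondegenerate P ->
  measurable (face P j).
Proof.
move=> nP; apply: measurableI; first exact: measurable_simplex.
rewrite -[X in measurable X]setTI.
have : measurable [set 0 : R] by exact: measurable_set1.
exact: measurable_bary.
Qed.

Lemma simplex_bounded k d (P : 'M[R]_(k.+1, d)) :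
  exists c, forall x i, simplex P x -> `|x 0 i| <= c.
Proof.
exists (\sum_i \sum_j `|P i j|) => x i [t [t0 t1 ->]].
rewrite mxE (le_trans (ler_norm_sum _ _ _))//; apply: ler_sum => j _.
rewrite (bigD1 i)//= ler_wpDr ?sumr_ge0// normrM ler_piMl//.
rewrite ger0_norm// -t1 (bigD1 j)//= lerDl sumr_ge0//.
Qed.

Lemma measurable_box n (a b : 'rV[R]_n) :
  measurable [set x : 'rV[R]_n | forall i, x 0 i \in `[a 0 i, b 0 i]].
Proof.
rewrite (_ : [set x | _] = \big[setI/setT]_(i < n)
    ((fun x : 'rV[R]_n => x 0 i) @^-1` `[a 0 i, b 0 i])).
  apply: bigsetI_measurable => i _.
  by rewrite -[X in measurable X]setTI; exact: measurable_rV_coord.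
rewrite -bigcap_seq; apply/seteqP; split => x /= H i => [_|]; first exact: H.
by apply: H; rewrite /= mem_index_enum.
Qed.

Lemma leb_bounded_lty n (A : set 'rV[R]_n) c : measurable A ->
  (forall x i, A x -> `|x 0 i| <= c) -> (leb n A < +oo)%E.
Proof.
move=> mA Ac.
(* The bound [c] may be negative, for instance when A is empty, while [leb_box] asks for ordered
   endpoints. *)
pose a : 'rV[R]_n := const_mx (- `|c|); pose b : 'rV[R]_n := const_mx `|c|.
apply: (@le_lt_trans _ _
  (leb n [set x : 'rV[R]_n | forall i, x 0 i \in `[a 0 i, b 0 i]])).
  apply: le_measure; rewrite ?inE//; first exact: measurable_box.
  move=> x Ax i; rewrite !mxE in_itv /= -ler_norml.
  exact: le_trans (Ac _ _ Ax) (ler_norm c).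
by rewrite leb_box ?ltry// => i; rewrite !mxE ge0_cp.
Qed.

(** The total mass is the Gram factor times the Lebesgue measure of the standard simplex, which is
    bounded. *)
Lemma surface_measure_lty k d (P : 'M[R]_(k.+1, d)) A :
  measurable A -> (surface_measure P A < +oo)%E.
Proof.
move=> mA; rewrite /surface_measure /pushforward /mscale /= /mrestr.
apply: lte_mul_pinfty => //.
apply: (@le_lt_trans _ _ (leb k (std_simplex k))).
  apply: le_measure; rewrite ?inE; [|exact: measurable_std_simplex|by move=> x []].
  apply: measurableI; last exact: measurable_std_simplex.
  by rewrite -[X in measurable X]setTI; exact: measurable_param.
apply: (@leb_bounded_lty _ _ 1); first exact: measurable_std_simplex.
move=> x i [x0 x1]; rewrite ger0_norm//; apply: le_trans x1.
by rewrite (bigD1 i)//= lerDl sumr_ge0.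
Qed.

End simplex_measurability.

(** * Weighted moments of polynomials: integrability and bilinearity *)

Section weighted_moments.
Context {R : realType} {n : nat}.
Implicit Types (p r : mpoly n.+1 R) (A : set 'rV[R]_n.+1) (w : 'rV[R]_n.+1 -> R).

Lemma measurable_pfun p : measurable_fun [set: 'rV[R]_n.+1] (pfun p).
Proof.
rewrite /pfun; under eq_fun do rewrite mevalE.
apply: measurable_sum => m; apply: measurable_funM => //.
apply: measurable_prod => i _; apply: measurable_funX.
exact: measurable_rV_coord.
Qed.

Lemma pfun_bounded p A c : (forall x i, A x -> `|x 0 i| <= c) ->
  exists C, forall x, A x -> `|pfun p x| <= C.
Proof.
move=> Ac.
exists (\sum_(m <- msupp p) `|mcoeff m p| * \prod_i c ^+ m i) => x Ax.
rewrite /pfun mevalE (le_trans (ler_norm_sum _ _ _))//.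
apply: ler_sum => m _; rewrite normrM ler_wpM2l// normr_prod.
apply: ler_prod => i _.
by rewrite normr_ge0 normrX lerXn2r ?nnegrE ?Ac// (le_trans _ (Ac x i Ax)).
Qed.

(** Common form of the pairings on the element and on its faces, so that linearity and transport are
    proved once for both. *)
Definition moment (mu : {measure set 'rV[R]_n.+1 -> \bar R}) A w p r : R :=
  \int[mu]_(x in A) (pfun p x * pfun r x * w x).

Section fixed_measure.
Variables (mu : {measure set 'rV[R]_n.+1 -> \bar R}) (A : set 'rV[R]_n.+1).
Hypothesis mA : measurable A.
Hypothesis bA : exists c, forall x i, A x -> `|x 0 i| <= c.

Lemma bounded_pfunM p r : [bounded pfun p x * pfun r x | x in A].
Proof.
have [c Ac] := bA; have [P Pp] := pfun_bounded p Ac.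
have [Q Qr] := pfun_bounded r Ac.
exists (P * Q); split; first exact: num_real.
move=> M PQM x Ax; rewrite /= normrM (le_trans _ (ltW PQM))//.
by rewrite ler_pM// ?Pp ?Qr.
Qed.

Lemma measurable_pfunM p r :
  measurable_fun A (fun x : 'rV[R]_n.+1 => pfun p x * pfun r x).
Proof.
by apply: measurable_funTS; apply: measurable_funM; exact: measurable_pfun.
Qed.

(** Integrability without the weight, as the change-of-variables conditions require of their test
    functions. *)
Lemma integrable_pfunM p r : (mu A < +oo)%E ->
  mu.-integrable A (EFin \o (fun x => pfun p x * pfun r x)).
Proof.
move=> muA; apply: measurable_bounded_integrable => //.
  exact: measurable_pfunM.
exact: bounded_pfunM.
Qed.

Variable w : 'rV[R]_n.+1 -> R.
Hypothesis iw : mu.-integrable A (EFin \o w).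

(** The weight is only integrable, but on A the polynomial factor is measurable and bounded. *)
Lemma integrable_moment p r :
  mu.-integrable A (EFin \o (fun x => pfun p x * pfun r x * w x)).
Proof. exact: integrableMr (measurable_pfunM p r) (bounded_pfunM p r) iw. Qed.

Lemma momentD p1 p2 r :
  moment mu A w (p1 + p2) r = moment mu A w p1 r + moment mu A w p2 r.
Proof.
rewrite /moment -RintegralD//; [|exact: integrable_moment..].
by apply: eq_Rintegral => x _; rewrite /pfun mevalD; ring.
Qed.

Lemma momentZ a p r : moment mu A w (a *: p) r = a * moment mu A w p r.
Proof.
rewrite /moment -RintegralZl//; last exact: integrable_moment.
by apply: eq_Rintegral => x _; rewrite /pfun mevalZ; ring.
Qed.

Lemma moment_lin (I : finType) (a : I -> R) (F : I -> mpoly n.+1 R) r :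
  moment mu A w (\sum_i a i *: F i) r = \sum_i a i * moment mu A w (F i) r.
Proof.
have moment0 : moment mu A w 0 r = 0.
  by rewrite -(scale0r 0) momentZ mul0r.
rewrite (big_morph (fun p => moment mu A w p r)
  (fun p1 p2 => momentD p1 p2 r) moment0).
by apply: eq_bigr => i _; rewrite momentZ.
Qed.

Lemma moment_linr (I : finType) (a : I -> R) (F : I -> mpoly n.+1 R) p :
  moment mu A w p (\sum_i a i *: F i) = \sum_i a i * moment mu A w p (F i).
Proof.
have momentC p1 p2 : moment mu A w p1 p2 = moment mu A w p2 p1.
  by apply: eq_Rintegral => x _; rewrite (mulrC (pfun p1 x)).
by rewrite momentC moment_lin; apply: eq_bigr => i _; rewrite momentC.
Qed.

End fixed_measure.
End weighted_moments.

(** * From local data to the moment matrices *)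

Section local_data_moments.
Context {R : realType} {n : nat}.
Variable D : local_data R n.
Hypothesis setting : local_setting D.

Let nd : Defs.nondegenerate (vtx D).
Proof. by have [[]] := setting. Qed.

Lemma elt_bounded : exists c, forall x i, elt D x -> `|x 0 i| <= c.
Proof. exact: simplex_bounded. Qed.

Lemma fac_bounded j : exists c, forall x i, fac D j x -> `|x 0 i| <= c.
Proof. by have [c Pc] := elt_bounded; exists c => x i [/Pc]. Qed.

Lemma measurable_elt : measurable (elt D).
Proof. exact: measurable_simplex. Qed.

Lemma measurable_fac j : measurable (fac D j).
Proof. exact: measurable_face. Qed.

Lemma leb_elt_lty : (leb n.+1 (elt D) < +oo)%E.
Proof.
by have [c Pc] := elt_bounded; exact: leb_bounded_lty measurable_elt Pc.
Qed.

Lemma surf_fac_lty j : (surf D j (fac D j) < +oo)%E.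
Proof. exact: surface_measure_lty (measurable_fac j). Qed.

Lemma integrable_Om : (leb n.+1).-integrable (elt D) (EFin \o Om D).
Proof. by have [[_ []]] := setting. Qed.

Lemma integrable_om j : (surf D j).-integrable (fac D j) (EFin \o om D j).
Proof. by have [[_ _ _ /(_ j)[[]]]] := setting. Qed.

Definition comb (a : 'cV[R]_(tdim n.+1)) (b : 'cV[R]_n.+2) : mpoly n.+1 R :=
  \sum_k a k 0 *: rho D k + \sum_i b i 0 *: psi D i.

Lemma Vfun_comb a b k :
  Vfun D k (pfun (comb a b)) = (Gmx D *m a + Cmx D *m b) k 0.
Proof.
have mE := measurable_elt; have bE := elt_bounded; have iO := integrable_Om.
rewrite -[LHS]/(moment (leb n.+1) (elt D) (Om D) (comb a b) (rho D k)).
rewrite momentD// !moment_lin// !mxE.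
by congr (_ + _); apply: eq_bigr => l _; rewrite mxE mulrC.
Qed.

Lemma Lfun_comb a b j :
  Defs.Lfun D j (pfun (comb a b)) = (Ctmx D *m a + Mmx D *m b) j 0.
Proof.
have mF := measurable_fac j; have bF := fac_bounded j.
have io := integrable_om j.
rewrite -[LHS]/(moment (surf D j) (fac D j) (om D j) (comb a b) (q D j)).
rewrite momentD// !moment_lin// !mxE.
by congr (_ + _); apply: eq_bigr => l _; rewrite mxE mulrC.
Qed.

Lemma dotOm_rho (a : 'cV[R]_(tdim n.+1)) (v := \sum_k a k 0 *: rho D k) :
  dotOm D (pfun v) (pfun v) = qform (Gmx D) a.
Proof.
have mE := measurable_elt; have bE := elt_bounded; have iO := integrable_Om.
rewrite -[LHS]/(moment (leb n.+1) (elt D) (Om D) v v).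
rewrite moment_linr// /qform -mulmxA mxE; apply: eq_bigr => k _.
rewrite mxE moment_lin// mxE; congr (_ * _).
by apply: eq_bigr => l _; rewrite mxE mulrC.
Qed.

Lemma infsup_quotientE f eta zeta (l : 'cV[R]_n.+2) (g : 'cV[R]_(tdim n.+1)) :
  (forall j, Defs.Lfun D j f = l j 0) -> (forall k, Vfun D k f = g k 0) ->
  infsup_quotient D f eta zeta = mx_quotient (Gmx D) (Mmx D) l g eta zeta.
Proof.
move=> Lf Vf; rewrite /infsup_quotient /mx_quotient; congr (_ / _).
by rewrite !mxE; congr (_ + _); apply: eq_bigr => i _; rewrite mxE ?Lf ?Vf.
Qed.

(** The index sets of both infima are images of sets of coefficient vectors, and the functionals at
    v + w are linear in the coefficients. *)
Lemma infsupE : infsup D = mx_infsup (Gmx D) (Cmx D) (Ctmx D) (Mmx D).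
Proof.
have supE a b :
    ereal_sup [set (infsup_quotient D (pfun (comb a b)) z.1 z.2)%:E
      | z in [set z : 'cV[R]_n.+2 * 'cV[R]_(tdim n.+1) | z != 0]] =
    ereal_sup [set (mx_quotient (Gmx D) (Mmx D) (Ctmx D *m a + Mmx D *m b)
                      (Gmx D *m a + Cmx D *m b) z.1 z.2)%:E
      | z in [set z : 'cV[R]_n.+2 * 'cV[R]_(tdim n.+1) | z != 0]].
  congr ereal_sup; apply: eq_imagel => z _; congr EFin.
  by apply: infsup_quotientE => i; [exact: Lfun_comb|exact: Vfun_comb].
have colE m (a : 'I_m -> R) i : a i = (\col_i a i) i 0 by rewrite mxE.
have VE : [set v | inV D v /\ normOm D (pfun v) = 1] =
    (fun a : 'cV[R]_(tdim n.+1) => \sum_k a k 0 *: rho D k) @`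
      [set a | qform (Gmx D) a = 1].
  apply/seteqP; split=> [v [[a ->]]|_ [a /= Ga1 <-]]; last first.
    split; first by exists (fun k => a k 0).
    by rewrite /normOm dotOm_rho Ga1 sqrtr1.
  under eq_bigr do rewrite colE.
  rewrite /normOm dotOm_rho => Ga1; exists (\col_k a k) => //=.
  (* [Num.sqrt] is 0 on negative reals, so norm one excludes a negative value of the form. *)
  have [Ga0|/ltW/ler0_sqrtr Ga0] := leP 0 (qform (Gmx D) (\col_k a k)).
    by rewrite -[LHS]sqr_sqrtr// Ga1 expr1n.
  by move: Ga1; rewrite Ga0 => /esym/eqP; rewrite oner_eq0.
have WE : [set w | inW D w] =
    (fun b : 'cV[R]_n.+2 => \sum_i b i 0 *: psi D i) @` setT.
  apply/seteqP; split=> [w [b ->]|_ [b _ <-]]; last by exists (fun i => b i 0).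
  by exists (\col_i b i) => //; apply: eq_bigr => i _; rewrite -colE.
rewrite /infsup VE image_comp; congr ereal_inf; apply: eq_imagel => a _ /=.
rewrite WE image_comp; congr ereal_inf; apply: eq_imagel => b _ /=.
exact: supE.
Qed.

End local_data_moments.

(** * Transport of moments to the reference simplex, and the conclusion *)

Lemma moment_transport (R : realType) (n : nat)
    (mu nu : {measure set 'rV[R]_n.+1 -> \bar R}) (A B : set 'rV[R]_n.+1)
    (w w' : 'rV[R]_n.+1 -> R) (phi psi : 'rV[R]_n.+1 -> 'rV[R]_n.+1)
    (p p' r r' : mpoly n.+1 R) :
  measurable A -> (exists c, forall x i, A x -> `|x 0 i| <= c) ->
  (mu A < +oo)%E -> cancel phi psi -> A = phi @` B ->
  (forall f : 'rV[R]_n.+1 -> R, mu.-integrable A (EFin \o f) ->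
     (\int[mu]_(x in A) (f x * w x)%:E =
      \int[nu]_(x in B) (f (phi x) * w' x)%:E)%E) ->
  (forall x, A x -> pfun p x = pfun p' (psi x)) ->
  (forall x, A x -> pfun r x = pfun r' (psi x)) ->
  moment mu A w p r = moment nu B w' p' r'.
Proof.
move=> mA bA muA phiK AE change pE rE; rewrite /moment /Rintegral.
(* The change of variables is applied to the product of the two polynomials, with the weight kept
   apart. *)
rewrite (change (fun x => pfun p x * pfun r x)); last exact: integrable_pfunM.
congr fine; apply: eq_integral => x; rewrite inE => Bx.
have Ax : A (phi x) by rewrite AE; exists x.
by rewrite pE// rE// phiK.
Qed.

Theorem theorem5 (R : realType) (n : nat) (d_ge2 : (2 <= n.+1)%N)
    (Dhat : local_data R n)
    (H : Type) (T : H -> finType) (D : forall h : H, T h -> local_data R n)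
    (Phi PhiInv : forall h : H, T h -> 'rV[R]_n.+1 -> 'rV[R]_n.+1)
    (setting_hat : local_setting Dhat)
    (setting_K : forall h (K : T h), local_setting (D h K))
    (mesh : forall h, simplicial_mesh (fun K : T h => vtx (D h K)))
    (Phi_affine : forall h (K : T h), affine_map (Phi h K))
    (PhiK : forall h (K : T h), cancel (Phi h K) (PhiInv h K))
    (PhiInvK : forall h (K : T h), cancel (PhiInv h K) (Phi h K))
    (elt_image : forall h (K : T h), elt (D h K) = Phi h K @` elt Dhat)
    (fac_image : forall h (K : T h) (j : 'I_(n.+2)),
       fac (D h K) j = Phi h K @` fac Dhat j)
    (cond1 : forall h (K : T h) (f : 'rV[R]_n.+1 -> R),
       (leb n.+1).-integrable (elt (D h K)) (EFin \o f) ->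
       (\int[leb n.+1]_(x in elt (D h K)) (f x * Om (D h K) x)%:E =
        \int[leb n.+1]_(x in elt Dhat) (f (Phi h K x) * Om Dhat x)%:E)%E)
    (cond2 : forall h (K : T h) (j : 'I_(n.+2)) (g : 'rV[R]_n.+1 -> R),
       (surf (D h K) j).-integrable (fac (D h K) j) (EFin \o g) ->
       (\int[surf (D h K) j]_(x in fac (D h K) j) (g x * om (D h K) j x)%:E =
        \int[surf Dhat j]_(x in fac Dhat j)
          (g (Phi h K x) * om Dhat j x)%:E)%E)
    (cond3_rho : forall h (K : T h) k x, elt (D h K) x ->
       pfun (rho (D h K) k) x = pfun (rho Dhat k) (PhiInv h K x))
    (cond3_psi : forall h (K : T h) j x, elt (D h K) x ->
       pfun (psi (D h K) j) x = pfun (psi Dhat j) (PhiInv h K x))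
    (cond3_q : forall h (K : T h) j x, fac (D h K) j x ->
       pfun (q (D h K) j) x = pfun (q Dhat j) (PhiInv h K x))
    (cond4 : spd (Shat Dhat)) :
  (forall h (K : T h),
     [/\ Gmx (D h K) = Gmx Dhat, Cmx (D h K) = Cmx Dhat,
         Ctmx (D h K) = Ctmx Dhat & Mmx (D h K) = Mmx Dhat]) /\
  (forall h (K : T h), Shat (D h K) = Shat Dhat) /\
  (forall h (K : T h), infsup (D h K) = infsup Dhat) /\
  (0 < infsup Dhat)%E.

Proof.
have moments h (K : T h) : [/\ Gmx (D h K) = Gmx Dhat, Cmx (D h K) = Cmx Dhat,
    Ctmx (D h K) = Ctmx Dhat & Mmx (D h K) = Mmx Dhat].
  have transport_elt := moment_transport (measurable_elt (setting_K h K))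
    (elt_bounded (D h K)) (leb_elt_lty (setting_K h K))
    (PhiK h K) (elt_image h K) (cond1 h K).
  have transport_fac j := moment_transport (measurable_fac (setting_K h K) j)
    (fac_bounded (D h K) j) (surf_fac_lty (setting_K h K) j)
    (PhiK h K) (fac_image h K j) (cond2 h K j).
  (* The relations for [rho] and [psi] are given on the element; the matrices [Ctmx] and [Mmx] use
     them on the faces. *)
  have fac_elt j x : fac (D h K) j x -> elt (D h K) x by case.
  split; apply/matrixP => i j; rewrite [LHS]mxE [RHS]mxE.
  - exact: transport_elt (cond3_rho h K j) (cond3_rho h K i).
  - exact: transport_elt (cond3_psi h K j) (cond3_rho h K i).
  - apply: transport_fac (cond3_q h K i) => x /fac_elt; exact: cond3_rho.
  - apply: transport_fac (cond3_q h K i) => x /fac_elt; exact: cond3_psi.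
split; first exact: moments.
split=> [h K|].
  have [GE CE CtE ME] := moments h K.
  by rewrite /Shat /Smx /K11 /K12 /K21 /K22 GE CE CtE ME.
split=> [h K|].
  have [GE CE CtE ME] := moments h K.
  by rewrite (infsupE (setting_K h K)) (infsupE setting_hat) GE CE CtE ME.
rewrite (infsupE setting_hat); apply: mx_infsup_gt0 cond4.
by have [_ [_ []]] := setting_hat.
Qed.
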